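(* Let $a\in\mathbb{R}$ and $r\geq0$ an integer. Let $F$ be infinitely differentiable in a neighborhood of $0$ with $F(x)=\sum_{n\geq0}f_n\frac{x^n}{n!}$, and let $G,H$ be infinitely differentiable in a neighborhood of $a$ with $G(x)=\sum_{n\geq1}g_n\frac{(x-a)^n}{n!}$ and $H(x)=\sum_{n\geq1}h_n\frac{(x-a)^n}{n!}$ (so $f_n=F^{(n)}(0)$, $G(a)=0$, $g_n=G^{(n)}(a)$, $h_n=H^{(n)}(a)$). Then for every integer $n\geq0$, $$\left.\frac{d^n}{dx^n}\left(\left(\frac{d}{dx}H(x)\right)^rF(G(x))\right)\right|_{x=a}=\sum_{k=0}^nf_k\,B^{(r)}_{n+r,k+r}(g_1,g_2,\ldots;h_1,h_2,\ldots).$$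
   Context: For sequences $a=(a_l)_{l\geq1}$, $b=(b_l)_{l\geq1}$ and integers $N,K,r\geq0$, the partial $r$-Bell polynomial is $$B^{(r)}_{N,K}(a_1,a_2,\ldots;b_1,b_2,\ldots)=\sum_{\pi}\ \prod_{B\in\pi,\ B\cap\{1,\ldots,r\}=\emptyset}a_{|B|}\prod_{B\in\pi,\ B\cap\{1,\ldots,r\}\neq\emptyset}b_{|B|},$$ where $\pi$ ranges over the partitions of $\{1,\ldots,N\}$ into exactly $K$ nonempty blocks such that $1,\ldots,r$ lie in pairwise distinct blocks (an empty sum is $0$; the empty partition of the empty set contributes $1$). *)

(* Defs.v *)
(* MathComp, with MathComp-Analysis for the derivatives. *)
From mathcomp Require Import all_boot all_order all_algebra.
Set Implicit Arguments.
Unset Strict Implicit.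
Unset Printing Implicit Defensive.
Import Order.TTheory GRing.Theory Num.Theory.
Local Open Scope ring_scope.

(* {1, ..., N} is encoded as 'I_N, the integer m being the ordinal m - 1. *)
Definition first_elts (r N : nat) : {set 'I_N} := [set i : 'I_N | (i < r)%N].

(* The condition r <= N is part of "1, ..., r lie in blocks": for r > N there
   is no admissible partition. *)
Definition r_partition (r N K : nat) (P : {set {set 'I_N}}) : bool :=
  [&& partition P [set: 'I_N], #|P| == K, (r <= N)%N &
      [forall i in first_elts r N, forall j in first_elts r N,
         (i != j) ==> (pblock P i != pblock P j)]].

(* Only the values of a and b at positive indices matter, as the blocks of a
   partition are nonempty. *)
Definition rBell (R : comNzRingType) (r N K : nat) (a b : nat -> R) : R :=
  \sum_(P : {set {set 'I_N}} | r_partition r K P)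
    (\prod_(B in P | B :&: first_elts r N == set0) a #|B|) *
    (\prod_(B in P | B :&: first_elts r N != set0) b #|B|).

(* Imported only here: its [set] notations, set0 and partition shadow those of
   finset used above. *)
From mathcomp Require Import all_classical all_reals all_analysis.
Import numFieldNormedType.Exports.
Local Open Scope ring_scope.
Local Open Scope classical_set_scope.

Definition smooth_near (R : realType) (x : R) (f : R -> R) : Prop :=
  \forall y \near x, forall n : nat, derivable f^`(n) y 1.

(* Main.v *)
(* Put S = {1, ..., r} and give a block B the weight a_|B|, b_|B| or 0 according
   to whether B meets S in 0, 1 or at least 2 points. For D containing S, let
   Phi_D(x) be the sum, over the partitions P of D, of F^(c)(G x) times the
   product of the weights of the blocks of P, where c is the number of blocks
   that miss S, a_j = G^(j)(x) and b_j = H^(j)(x). If z is outside D, then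
   Phi_D' = Phi_(D u {z}): the product rule either differentiates the factor of
   one block, which puts z into that block, or the factor F^(c)(G x), which
   makes {z} a new block. Only singletons contribute to Phi_S,
   hence Phi_S = (H')^r F(G), and the n-th derivative of
   (H')^r F(G) is Phi_D for any D with n more points than S. *)
Require Import Defs.
From mathcomp Require Import all_boot all_order all_algebra.
Set Implicit Arguments.
Unset Strict Implicit.
Unset Printing Implicit Defensive.
Import Order.TTheory GRing.Theory Num.Theory.
Local Open Scope ring_scope.

(** * Partitions of a set enlarged by one element *)

Section PartitionInsert.
Variables (T : finType) (x : T) (D : {set T}).
Hypothesis xND : x \notin D.

(* [p.2] is a block of [p.1], or [set0] when [x] is to form a block of its own. *)
Definition insert_block (p : {set {set T}} * {set T}) : {set {set T}} :=
  (x |: p.2) |: (p.1 :\ p.2).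

(** Inverse of [insert_block]. If [[set x]] is a block of [P], what remains of it is [set0], which
    is not a legal block: hence the final [:\ set0]. *)
Definition remove_elt (P : {set {set T}}) : {set {set T}} * {set T} :=
  let B := pblock P x :\ x in ((B |: (P :\ pblock P x)) :\ set0, B).

Lemma insert_blockP Q B : partition Q D -> B \in set0 |: Q ->
  partition (insert_block (Q, B)) (x |: D) /\ remove_elt (insert_block (Q, B)) = (Q, B).
Proof.
move=> partQ BQ.
have [/eqP covQ trivQ Q0] := and3P partQ.
have QD C : C \in Q -> C \subset D by move=> CQ; rewrite -covQ; apply: bigcup_sup.
have BD : B \subset D.
  by move: BQ; rewrite !inE => /orP[/eqP->|/QD//]; rewrite sub0set.
have xNB : x \notin B by apply: contra xND; apply/subsetP.
have xBN : x |: B \notin Q :\ B.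
  apply/negP; rewrite !inE => /andP[_ /QD /subsetP /(_ x)].
  by rewrite setU11 (negPf xND) => /(_ isT).
have disjB C : C \in Q -> C != B -> [disjoint C & B].
  move=> CQ CB; move: BQ; rewrite !inE => /orP[/eqP->|BQ].
    by rewrite -setI_eq0 setI0.
  by move/trivIsetP: trivQ; apply.
have partI : partition (insert_block (Q, B)) (x |: D).
  rewrite /insert_block /=; apply/and3P; split.
  - rewrite /cover big_setU1 //= -covQ /cover.
    apply/eqP/setP => y; rewrite !inE.
    case: eqP => //= _; apply/orP/bigcupP.
      move=> [yB|/bigcupP[C]]; last by rewrite !inE => /andP[_ CQ] yC; exists C.
      move: BQ; rewrite !inE => /orP[/eqP B0|BQ]; last by exists B.
      by rewrite B0 inE in yB.
    move=> [C CQ yC]; have [<-|CB] := eqVneq C B; first by left.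
    by right; apply/bigcupP; exists C => //; rewrite !inE CB.
  - apply/trivIsetP => C1 C2; rewrite !inE.
    have key C : C != B -> C \in Q -> [disjoint x |: B & C].
      move=> CB CQ; rewrite disjoint_sym -setI_eq0 setIUr setU_eq0 !setI_eq0 disjB //.
      rewrite andbT disjoint_sym disjoints1.
      by apply: contra xND; apply/subsetP/QD.
    move=> /predU1P[->|/andP[C1B C1Q]] /predU1P[->|/andP[C2B C2Q]] C12.
    + by rewrite eqxx in C12.
    + exact: key.
    + by rewrite disjoint_sym; exact: key.
    + by move/trivIsetP: trivQ; apply.
  - rewrite !inE (negPf Q0) andbF orbF.
    by apply/eqP => /setP/(_ x); rewrite !inE eqxx.
split=> //.
have pbx : pblock (insert_block (Q, B)) x = x |: B.
  by apply: def_pblock; [case/and3P: partI | exact: setU11 | exact: setU11].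
rewrite /remove_elt pbx /insert_block /= setU1K //; congr (_, _).
rewrite setU1K //; apply/setP => C; rewrite !inE.
have [->|C0] /= := eqVneq C set0; first by rewrite (negPf Q0).
have [CB|//] /= := eqVneq C B.
by move: BQ; rewrite -CB !inE (negPf C0) => /= ->.
Qed.

Lemma remove_eltP P : partition P (x |: D) ->
  [/\ partition (remove_elt P).1 D, (remove_elt P).2 \in set0 |: (remove_elt P).1
    & insert_block (remove_elt P) = P].
Proof.
move=> partP; have [/eqP covP trivP P0] := and3P partP.
have xP : x \in cover P by rewrite covP setU11.
set A := pblock P x.
have AP : A \in P by exact: pblock_mem.
have xA : x \in A by rewrite mem_pblock.
have xN C : C \in P -> C != A -> x \notin C.
  by move=> CP; apply: contra => xC; rewrite /A (def_pblock trivP CP xC).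
have disjA C y : C \in P -> C != A -> y \in C -> y \in A -> false.
  move=> CP CA yC yA; move: CA; rewrite -(def_pblock trivP CP yC).
  by rewrite (def_pblock trivP AP yA) eqxx.
have AB0 : A :\ x != A by apply/eqP => /setP/(_ x); rewrite !inE eqxx xA.
(* [insert_block] deletes [A :\ x] when it puts [A] back, so this set must not be one of the
   original blocks; it would meet the block [A]. *)
have NAP : A :\ x != set0 -> A :\ x \notin P.
  move=> /set0Pn[y yA]; apply/negP => AxP.
  by have := disjA _ _ AxP AB0 yA (subsetP (subsetDl _ _) _ yA).
rewrite /remove_elt -/A /=; split.
- apply/and3P; split.
  + apply/eqP/setP => y; apply/bigcupP/idP.
      move=> [C]; rewrite !inE => /andP[_ /predU1P[->|/andP[CA CP]]].
        rewrite !inE => /andP[yx yA].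
        have : y \in x |: D by rewrite -covP; apply/bigcupP; exists A.
        by rewrite !inE (negPf yx).
      move=> yC; have : y \in x |: D by rewrite -covP; apply/bigcupP; exists C.
      rewrite !inE => /predU1P[yx|//].
      by move: yC; rewrite yx (negPf (xN C CP CA)).
    move=> yD; have yx : y != x by apply: contraNneq xND => <-.
    have : y \in cover P by rewrite covP !inE yD orbT.
    move=> /bigcupP[C CP yC]; have [CA|CA] := eqVneq C A.
      exists (A :\ x); rewrite !inE ?eqxx -?CA ?yx ?yC //= andbT.
      by apply/set0Pn; exists y; rewrite !inE yx yC.
    exists C => //; rewrite !inE CA CP orbT andbT.
    by apply/set0Pn; exists y.
  + apply/trivIsetP => C1 C2; rewrite !inE.
    have key C : C != A -> C \in P -> [disjoint A :\ x & C].
      move=> CA CP; rewrite -setI_eq0; apply/set0Pn => -[y]; rewrite !inE.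
      by move=> /andP[/andP[_ yA] yC]; have := disjA _ _ CP CA yC yA.
    move=> /andP[_ /predU1P[->|/andP[C1B C1Q]]] /andP[_ /predU1P[->|/andP[C2B C2Q]]] C12.
    * by rewrite eqxx in C12.
    * exact: key.
    * by rewrite disjoint_sym; exact: key.
    * by move/trivIsetP: trivP; apply.
  + by rewrite !inE eqxx.
- by rewrite !inE eqxx; case: eqP.
- rewrite /insert_block /= setD1K //; apply/setP => C; rewrite !inE.
  have [->|CA] /= := eqVneq C A; first by rewrite AP.
  have [->|CAx] /= := eqVneq C (A :\ x).
    have [->|/NAP/negPf->//] := eqVneq (A :\ x) set0.
    by rewrite (negPf P0).
  by case: eqP => //= ->; rewrite (negPf P0).
Qed.

(** [insert_block] and [remove_elt] are mutually inverse bijections between the pairs [(Q, B)] and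
    the partitions of [x |: D]. The index [B = set0] stands for the partitions in which [x] is
    alone. *)
Lemma big_partitionU1 (R : Type) (idx : R) (op : Monoid.com_law idx)
    (E : {set {set T}} -> R) :
  \big[op/idx]_(P | partition P (x |: D)) E P =
  \big[op/idx]_(Q | partition Q D)
    \big[op/idx]_(B in set0 |: Q) E ((x |: B) |: (Q :\ B)).
Proof.
rewrite pair_big_dep /= (reindex_onto insert_block remove_elt); last first.
  by move=> P /remove_eltP[].
apply: eq_bigl => -[Q B] /=; apply/andP/andP.
  move=> [+ /eqP rem] => /remove_eltP[].
  by rewrite rem.
by move=> [partQ BQ]; have [-> ->] := insert_blockP partQ BQ.
Qed.

End PartitionInsert.

(** * Weighted sums over set partitions *)

Section PartitionSum.
Variables (R : comNzRingType) (T : finType) (S : {set T}).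
Implicit Types (D B : {set T}) (P Q : {set {set T}}) (f a b : nat -> R).

Definition block_weight a b B : R :=
  if #|B :&: S| == 0%N then a #|B| else if #|B :&: S| == 1%N then b #|B| else 0.

Definition new_blocks P : nat := (\sum_(B in P) (#|B :&: S| == 0))%N.

(** This is Phi_D at a fixed point x, where [f c], [a j] and [b j] stand for the numbers F^(c)(G x),
    G^(j)(x) and H^(j)(x). *)
Definition partition_sum D f a b : R :=
  \sum_(P | partition P D) f (new_blocks P) * \prod_(B in P) block_weight a b B.

(** Blocks are nonempty, so [a 0] and [b 0] never occur. The coefficients [g] and [h] of the theorem
    are prescribed only from index 1 on. *)
Lemma eq_partition_sum D f f' a a' b b' :
  f =1 f' -> (forall j, (0 < j)%N -> a j = a' j) ->
  (forall j, (0 < j)%N -> b j = b' j) ->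
  partition_sum D f a b = partition_sum D f' a' b'.
Proof.
move=> ff' aa' bb'; apply: eq_bigr => P /and3P[_ _ P0].
rewrite ff'; congr (_ * _); apply: eq_bigr => B BP.
have B0 : (0 < #|B|)%N by rewrite card_gt0; apply: contraNneq P0 => <-.
by rewrite /block_weight aa' ?bb'.
Qed.

Lemma partition_sumU1 x D f a b : x \notin D ->
  partition_sum (x |: D) f a b =
  \sum_(Q | partition Q D)
    (f (new_blocks Q + (x \notin S))%N *
       (block_weight a b [set x] * \prod_(B in Q) block_weight a b B) +
     \sum_(B in Q)
       f ((#|(x |: B) :&: S| == 0) + new_blocks (Q :\ B))%N *
         (block_weight a b (x |: B) * \prod_(C in Q :\ B) block_weight a b C)).
Proof.
move=> xND; rewrite /partition_sum big_partitionU1 //; apply: eq_bigr => Q partQ.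
have [/eqP covQ _ Q0] := and3P partQ.
have notin B : x |: B \notin Q :\ B.
  rewrite !inE negb_and; apply/orP; right; apply: contra xND => xBQ.
  by rewrite -covQ; apply/bigcupP; exists (x |: B); rewrite ?setU11.
(* The index [set0] is split off: it gives the new block [[set x]], while the other indices enlarge
   a block of [Q]. *)
rewrite big_setU1 //=; congr (_ + _).
  have QE : Q :\ set0 = Q by apply/setDidPl; rewrite disjoint_sym disjoints1.
  rewrite /new_blocks !big_setU1 ?notin //= QE setU0 addnC; congr (f (_ + _)%N * _).
  by rewrite cards_eq0 setI_eq0 disjoints1.
by apply: eq_bigr => B BQ; rewrite /new_blocks !big_setU1 ?notin.
Qed.

(** Every [D] inside [S] is allowed so that induction on [#|D|] applies. Adding [x] to an existing
    block would put two points of [S] in it and make its weight 0; so [x] stays alone and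
    contributes a factor [b 1]. *)
Lemma partition_sum_subset D f a b : D \subset S ->
  partition_sum D f a b = f 0%N * b 1%N ^+ #|D|.
Proof.
have [m] := ubnP #|D|; elim: m => // m IH in D f * => Dm DS.
have [->|[x xD]] := set_0Vmem D.
  rewrite /partition_sum; under eq_bigl do rewrite partition_set0.
  rewrite big_pred1_eq.
  by rewrite /new_blocks !big_set0 cards0.
have xDx : x \notin D :\ x by rewrite !inE eqxx.
have xS : x \in S by exact: (subsetP DS).
have DxS : D :\ x \subset S := subset_trans (subD1set _ _) DS.
have wx : block_weight a b [set x] = b 1%N.
  by rewrite /block_weight (setIidPl _) ?sub1set // cards1.
rewrite -[in LHS](setD1K xD) partition_sumU1 // (cardsD1 x D) xD exprS mulrCA.
(* Read from right to left, the induction hypothesis turns both sides into sums over the partitions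
   of [D :\ x], compared term by term. *)
rewrite -IH //; last by move: Dm; rewrite (cardsD1 x D) xD ltnS.
rewrite mulr_sumr; apply: eq_bigr => Q /and3P[/eqP covQ _ Q0].
rewrite xS addn0 wx [X in _ + X]big1 ?addr0 1?mulrCA // => B BQ.
have BS : B \subset S.
  by apply: subset_trans DxS; rewrite -covQ; exact: bigcup_sup.
have xNB : x \notin B.
  by apply: contra xDx => xB; rewrite -covQ; apply/bigcupP; exists B.
have B0 : #|B| != 0%N by rewrite cards_eq0; apply: contraNneq Q0 => <-.
rewrite /block_weight (setIidPl _) ?subUset ?sub1set ?xS //.
by rewrite cardsU1 xNB /= eqSS (negPf B0) mul0r mulr0.
Qed.

(** Each block either misses [S] or contains exactly one of its points, so it counts once on the
    right. *)
Lemma card_partition_new_blocks (D : {set T}) (P : {set {set T}}) :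
  partition P D -> S \subset D -> (forall B, B \in P -> #|B :&: S| <= 1)%N ->
  #|P| = (new_blocks P + #|S|)%N.
Proof.
move=> partP SD leP.
have -> : #|S| = (\sum_(B in P) #|B :&: S|)%N.
  rewrite -[in LHS](setIidPr SD) -sum1_card.
  transitivity (\sum_(x in D) (x \in S : nat))%N.
    by rewrite -big_mkcondr /=; apply: eq_bigl => x; rewrite inE.
  rewrite (set_partition_big _ partP); apply: eq_bigr => B BP.
  by rewrite -big_mkcondr -sum1_card; apply: eq_bigl => x; rewrite inE.
rewrite -sum1_card -big_split; apply: eq_bigr => B /leP /=.
by case: #|_| => [|[]].
Qed.

Lemma prod_block_weight0 (P : {set {set T}}) a b :
  ~~ [forall B in P, #|B :&: S| <= 1]%N ->
  \prod_(B in P) block_weight a b B = 0.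
Proof.
move=> /forall_inPn[B BP]; rewrite -ltnNge => lt1.
rewrite (bigD1 B) //= /block_weight.
by case: #|_| lt1 => [|[]] // ? _; rewrite mul0r.
Qed.

End PartitionSum.

(** * The r-Bell polynomials as weighted sums over all partitions *)

Lemma r_partitionE (r N K : nat) (P : {set {set 'I_N}}) : (r <= N)%N ->
  r_partition r K P = [&& partition P [set: 'I_N], #|P| == K &
    [forall B in P, #|B :&: first_elts r N| <= 1]%N].
Proof.
move=> rN; rewrite /r_partition rN /=.
case partP : (partition _ _) => //=; case: (_ == _) => //=.
have [/eqP covP trivP P0] := and3P partP.
have inP (x : 'I_N) : x \in cover P by rewrite covP inE.
apply/forall_inP/forall_inP => [sep B BP|le1 i].
  apply/card_le1_eqP => i j.
  rewrite !inE => /andP[iB ir] /andP[jB jr]; apply/eqP; apply: contraTT isT => ij.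
  have /sep/forall_inP/(_ j) : i \in first_elts r N by rewrite inE.
  rewrite inE => /(_ jr).
  by rewrite eq_sym ij /= (def_pblock trivP BP iB) (def_pblock trivP BP jB) eqxx.
rewrite inE => ir; apply/forall_inP => j; rewrite inE => jr; apply/implyP.
apply: contraNneq => pij; apply/eqP.
have /card_le1_eqP := le1 _ (pblock_mem (inP i)).
by apply; rewrite !inE ?ir ?jr ?andbT ?mem_pblock // pij mem_pblock.
Qed.

Lemma card_first_elts r N : (r <= N)%N -> #|first_elts r N| = r.
Proof.
move=> rN; have widen_inj : injective (widen_ord rN).
  by move=> i j /(congr1 val) ij; apply: val_inj.
rewrite -[RHS]card_ord -(card_imset _ widen_inj).
apply: eq_card => i; rewrite inE; apply/idP/imsetP => [ir|[j _ ->]] //=.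
by exists (Ordinal ir) => //; apply: val_inj.
Qed.

(** The zero weight absorbs the separation condition: a partition violating it has a block with two
    points of [first_elts r N]. *)
Lemma rBellE (R : comNzRingType) (r N K : nat) (a b : nat -> R) : (r <= N)%N ->
  rBell r N K a b = \sum_(P : {set {set 'I_N}} | partition P [set: 'I_N] && (#|P| == K))
    \prod_(B in P) block_weight (first_elts r N) a b B.
Proof.
move=> rN; rewrite /rBell; under eq_bigl do rewrite r_partitionE // andbA.
rewrite big_mkcondr; apply: eq_bigr => P _.
case: ifPn => [/forall_inP good|/prod_block_weight0->//].
rewrite [RHS](bigID (fun B => B :&: first_elts r N == set0)) /=.
congr (_ * _); apply: eq_bigr => B /andP[BP]; rewrite /block_weight -cards_eq0.
  by move=> ->.
by have := good B BP; case: #|_ :&: _| => [|[]].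
Qed.

(** After exchanging the sums, a partition that separates the points of [S] has [new_blocks S P + r]
    blocks, so only [k = new_blocks S P] contributes; the other partitions have weight 0. *)
Lemma sum_rBell (R : comNzRingType) (r n : nat) (f a b : nat -> R) :
  \sum_(0 <= k < n.+1) f k * rBell r (n + r) (k + r) a b =
  partition_sum (first_elts r (n + r)) [set: 'I_(n + r)] f a b.
Proof.
set S := first_elts r (n + r).
have rn : (r <= n + r)%N by exact: leq_addl.
have cS : #|S| = r by rewrite card_first_elts.
under eq_bigr do rewrite rBellE // mulr_sumr big_mkcondr /=.
rewrite exchange_big; apply: eq_bigr => P partP /=.
have [good|/prod_block_weight0 bad] :=
    boolP [forall B in P, #|B :&: S| <= 1]%N; last first.
  by rewrite bad mulr0 big1 // => k _; rewrite mulr0 if_same.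
have cP : (#|P| = new_blocks S P + r)%N.
  rewrite (card_partition_new_blocks partP (subsetT S)) ?cS //.
  exact: (forall_inP good).
(* This [k] is in the range of summation, because [n + r] points form at most [n + r] nonempty
   blocks. *)
have newP : (new_blocks S P < n.+1)%N.
  rewrite ltnS -(leq_add2r r) -cP -[X in (_ <= X)%N]card_ord -cardsT.
  rewrite -sum1_card (card_partition partP) leq_sum // => B BP.
  rewrite card_gt0; apply: contraTneq BP => ->.
  by case/and3P: partP.
rewrite -big_mkcond /= big_mkord.
rewrite (big_pred1 (Ordinal newP)) // => k.
by rewrite cP eqn_add2r eq_sym.
Qed.

(** A point outside [S] does not change how a block meets [S], only its size, so the weights have
    their index shifted by one. The right-hand side thus has the shape of a product rule. *)
Lemma partition_sumU1_notin (R : comNzRingType) (T : finType) (S D : {set T})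
    (x : T) (f a b : nat -> R) : x \notin D -> x \notin S ->
  partition_sum S (x |: D) f a b =
  \sum_(Q | partition Q D)
    (f (new_blocks S Q).+1 * a 1%N * \prod_(B in Q) block_weight S a b B +
     f (new_blocks S Q) * \sum_(B in Q)
       block_weight S (fun j => a j.+1) (fun j => b j.+1) B *
         \prod_(C in Q :\ B) block_weight S a b C).
Proof.
move=> xND xNS; rewrite partition_sumU1 //; apply: eq_bigr => Q partQ.
have xS : [disjoint [set x] & S] by rewrite disjoints1.
have wx : block_weight S a b [set x] = a 1%N.
  by rewrite /block_weight (disjoint_setI0 xS) cards0 cards1.
rewrite xNS addn1 wx mulrA; congr (_ + _); rewrite mulr_sumr.
apply: eq_bigr => B BQ.
have xNB : x \notin B.
  apply: contra xND => xB; case/and3P: partQ => /eqP <- _ _.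
  by apply/bigcupP; exists B.
have xBS : (x |: B) :&: S = B :&: S by rewrite setIUl (disjoint_setI0 xS) set0U.
rewrite /new_blocks [in RHS](big_setD1 B) //= xBS; congr (_ * (_ * _)).
by rewrite /block_weight xBS cardsU1 xNB.
Qed.

(* Imported only here: it shadows the notations and lemmas of finset used above. *)
From mathcomp Require Import all_classical all_reals all_analysis.
Import numFieldNormedType.Exports.
Local Open Scope ring_scope.
Local Open Scope classical_set_scope.

(** * Derivatives of partition sums *)

Section Derivatives.
Variable R : realType.

Lemma is_derive_bigsum (I : Type) (s : seq I) (p : pred I) (u : I -> R -> R)
    (du : I -> R) (x : R) :
  (forall i, p i -> is_derive x (1 : R) (u i) (du i)) ->
  is_derive x (1 : R) (fun y => \sum_(i <- s | p i) u i y)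
    (\sum_(i <- s | p i) du i).
Proof.
move=> ud; rewrite (_ : (fun y => _) = \sum_(i <- s | p i) u i); last first.
  by apply/funext => y; rewrite fct_sumE.
by elim/big_ind2 : _ => // [|] *; [exact: is_derive_cst|exact: is_deriveD].
Qed.

Lemma is_derive_prod_set (T : finType) (A : {set T}) (u : T -> R -> R)
    (du : T -> R) (x : R) :
  (forall i, i \in A -> is_derive x (1 : R) (u i) (du i)) ->
  is_derive x (1 : R) (fun y => \prod_(i in A) u i y)
    (\sum_(i in A) du i * \prod_(j in A :\ i) u j x).
Proof.
have [m] := ubnP #|A|; elim: m => // m IH in A * => Am ud.
have [->|[i iA]] := set_0Vmem A.
  under eq_fun do rewrite big_set0; rewrite big_set0; exact: is_derive_cst.
have {IH} IH : is_derive x (1 : R) (fun y => \prod_(k in A :\ i) u k y)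
    (\sum_(k in A :\ i) du k * \prod_(j in A :\ i :\ k) u j x).
  apply: IH => [|k]; first by move: Am; rewrite (cardsD1 i A) iA ltnS.
  by rewrite inE => /andP[_ kA]; exact: ud.
under eq_fun do rewrite (big_setD1 i) //=.
have := ud i iA => di.
apply: (is_derive_eq (is_deriveM di IH)).
rewrite [in RHS](big_setD1 i) //= addrC; congr (_ + _).
  rewrite /GRing.scale /= mulr_sumr; apply: eq_bigr => k.
  rewrite !inE => /andP[ki kA].
  rewrite [in RHS](big_setD1 i) ?inE ?iA 1?eq_sym ?ki //= [RHS]mulrCA.
  by rewrite !finset.setDDl finset.setUC.
exact: mulrC.
Qed.

(** The hypothesis on [f] is the chain rule for F^(k)(G), with [a 1] in the role of G'. The product
    rule for the term of [Q] gives exactly the summand of [partition_sumU1_notin]. *)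
Lemma is_derive_partition_sum (T : finType) (S D : {set T}) (z : T)
    (f a b : nat -> R -> R) (x : R) : z \notin D -> z \notin S ->
  (forall k, is_derive x (1 : R) (f k) (f k.+1 x * a 1%N x)) ->
  (forall j, is_derive x (1 : R) (a j) (a j.+1 x)) ->
  (forall j, is_derive x (1 : R) (b j) (b j.+1 x)) ->
  is_derive x (1 : R) (fun y => partition_sum S D (f^~ y) (a^~ y) (b^~ y))
    (partition_sum S (z |: D)%SET (f^~ x) (a^~ x) (b^~ x)).
Proof.
move=> zD zS df da db; rewrite partition_sumU1_notin // /partition_sum.
apply: is_derive_bigsum => Q _.
have dprod : is_derive x (1 : R)
    (fun y => \prod_(B in Q) block_weight S (a^~ y) (b^~ y) B)
    (\sum_(B in Q) block_weight S (fun j => a j.+1 x) (fun j => b j.+1 x) B *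
      \prod_(C in Q :\ B) block_weight S (a^~ x) (b^~ x) C).
  apply: (@is_derive_prod_set _ Q (fun B y => block_weight S (a^~ y) (b^~ y) B)).
  move=> B _; rewrite /block_weight; case: eqP => // _; case: eqP => // _.
  exact: is_derive_cst.
apply: (is_derive_eq (is_deriveM (df (new_blocks S Q)) dprod)).
by rewrite addrC; congr (_ + _); rewrite /GRing.scale /= mulrC.
Qed.

(** The value and the derivability are separate claims because [T] is finite: the value makes sense
    even for [D] the full set, whereas the derivative of L^(n) is expressed through a further point
    [z] outside [D]. *)
Lemma is_derive_derive1n (T : finType) (S : {set T}) (f a b : nat -> R -> R)
    (U : set R) (L : R -> R) : open U ->
  (forall x k, U x -> is_derive x (1 : R) (f k) (f k.+1 x * a 1%N x)) ->
  (forall x j, U x -> is_derive x (1 : R) (a j) (a j.+1 x)) ->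
  (forall x j, U x -> is_derive x (1 : R) (b j) (b j.+1 x)) ->
  (forall x, U x -> L x = partition_sum S S (f^~ x) (a^~ x) (b^~ x)) ->
  forall (n : nat) (D : {set T}), S \subset D -> #|(D :\: S)%SET| = n ->
  forall x, U x -> L^`(n) x = partition_sum S D (f^~ x) (a^~ x) (b^~ x) /\
    forall z, z \notin D -> is_derive x (1 : R) L^`(n)
      (partition_sum S (z |: D)%SET (f^~ x) (a^~ x) (b^~ x)).
Proof.
move=> oU df da db LE.
(* The formula for L^(n) is assumed on all of the open set [U], hence near each of its points, so it
   may be differentiated. *)
have step (n : nat) (D : {set T}) (z : T) : S \subset D ->
    (forall x, U x -> L^`(n) x = partition_sum S D (f^~ x) (a^~ x) (b^~ x)) ->
    z \notin D -> forall x, U x -> is_derive x (1 : R) L^`(n)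
      (partition_sum S (z |: D)%SET (f^~ x) (a^~ x) (b^~ x)).
  move=> SD LnE zD x Ux.
  have zS : z \notin S by apply: contra zD; apply: (fintype.subsetP SD).
  apply: near_eq_is_derive (is_derive_partition_sum zD zS _ _ _); last first.
  - by move=> j; exact: db.
  - by move=> j; exact: da.
  - by move=> k; exact: df.
  have := open_nbhs_nbhs (conj oU Ux); apply: filterS => y Uy.
  by rewrite LnE.
suff val n (D : {set T}) : S \subset D -> #|(D :\: S)%SET| = n ->
    forall x, U x -> L^`(n) x = partition_sum S D (f^~ x) (a^~ x) (b^~ x).
  move=> n D SD Dn x Ux; split; first exact: val.
  by move=> z zD; apply: step => // y; exact: val.
elim: n D => [|n IH] D SD Dn x Ux.
  have -> : D = S.
    by apply/eqP; rewrite finset.eqEsubset SD andbT -finset.setD_eq0 -cards_eq0 Dn.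
  exact: LE.
(* The point to insert is taken from [D] itself: the induction hypothesis applies to [D :\ z], and
   [step] puts [z] back. *)
have /card_gt0P[z zDS] : (0 < #|(D :\: S)%SET|)%N by rewrite Dn.
have [zD zS] : z \in D /\ z \notin S by move: zDS; rewrite inE => /andP[].
have zN : z \notin D :\ z by rewrite !inE eqxx.
have SDz : S \subset D :\ z by rewrite subsetD1 SD.
have cDz : #|((D :\ z) :\: S)%SET| = n.
  move: Dn; rewrite (cardsD1 z) zDS add1n => -[<-].
  by rewrite finset.setDDl finset.setUC -finset.setDDl.
have := step n _ _ SDz (IH _ SDz cDz) zN x Ux.
by rewrite finset.setD1K // derive1nS derive1E => /@derive_val.
Qed.

End Derivatives.

Theorem theorem6 (R : realType) (a : R) (r : nat) (F G H : R -> R)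
    (f g h : nat -> R)
    (smoothF : smooth_near 0 F)
    (smoothG : smooth_near a G)
    (smoothH : smooth_near a H)
    (fE : forall n : nat, f n = F^`(n) 0)
    (G0 : G a = 0)
    (gE : forall n : nat, (1 <= n)%N -> g n = G^`(n) a)
    (H0 : H a = 0)
    (hE : forall n : nat, (1 <= n)%N -> h n = H^`(n) a) :
  smooth_near a (fun x : R => (H^`()%classic x) ^+ r * F (G x)) /\
  forall n : nat,
    (fun x : R => (H^`()%classic x) ^+ r * F (G x))^`(n) a =
      \sum_(0 <= k < n.+1) f k * rBell r (n + r) (k + r) g h.
Proof.
set L := (fun x => _).
have deriv (u : R -> R) x n : derivable u^`(n) x 1 ->
    is_derive x (1 : R) u^`(n) (u^`(n.+1) x).
  by move=> du; rewrite derive1nS derive1E; exact: derivableP.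
have contG : {for a, continuous G}.
  apply/differentiable_continuous/derivable1_diffP.
  exact: (nbhs_singleton smoothG 0%N).
(* The interior of [good] will be the open set [U]. That F is smooth at [G x] for x near [a] follows
   from the continuity of G and [G a = 0]. *)
pose good x := [/\ forall n, derivable G^`(n) x 1, forall n, derivable H^`(n) x 1
  & forall n, derivable F^`(n) (G x) 1].
have good_near : \forall x \near a, good x.
  have GF : \forall x \near a, forall n, derivable F^`(n) (G x) 1.
    by move: smoothF; rewrite /smooth_near -G0 => /contG.
  by apply: filterS3 smoothG smoothH GF => x; split.
(* The ground set is left free, since smoothness and the value at [a] use ground sets of different
   sizes. *)
have key (T : finType) (S : {set T}) : #|S| = r ->
    forall (n : nat) (D : {set T}), S \subset D -> #|(D :\: S)%SET| = n ->
    forall x, good° x ->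
    L^`(n) x = partition_sum S D (fun k => F^`(k) (G x)) (fun j => G^`(j) x)
      (fun j => H^`(j) x) /\
    forall z, z \notin D -> derivable L^`(n) x 1.
  move=> Sr n D SD Dn x Ux.
  have [] := @is_derive_derive1n R T S (fun k x => F^`(k) (G x))
    (fun j => G^`(j)) (fun j => H^`(j)) good° L (open_interior _)
    _ _ _ _ n D SD Dn x Ux.
  - move=> y k /interior_subset[dG _ dF].
    rewrite derive1n1; apply: is_derive1_comp; first exact: deriv.
    exact: (deriv G y 0%N).
  - by move=> y j /interior_subset[dG _ _]; exact: deriv.
  - by move=> y j /interior_subset[_ dH _]; exact: deriv.
  - by move=> y _; rewrite partition_sum_subset // Sr mulrC.
  by move=> -> dL; split=> // z /dL [].
have good_a : good° a by exact: good_near.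
split.
  apply: filterS (nbhs_interior good_near) => x Ux n.
  (* One point more than [n + r], so that [ord_max] lies outside [D] and can serve as the [z] that
     yields derivability of L^(n). *)
  pose N := (n + r).+1; pose D := first_elts (n + r) N.
  have rN : (r <= N)%N by rewrite leqW // leq_addl.
  have SD : first_elts r N \subset D.
    by apply/fintype.subsetP => i; rewrite !inE => /leq_trans; apply; exact: leq_addl.
  have Dn : #|(D :\: first_elts r N)%SET| = n.
    by rewrite cardsD (finset.setIidPr SD) !card_first_elts // addnK.
  have [_ /(_ ord_max)] := key _ _ (card_first_elts rN) n D SD Dn x Ux.
  by apply; rewrite inE ltnn.
move=> n; have rn : (r <= n + r)%N by exact: leq_addl.
(* Only the value is needed here, so [D] can be the full set, as [sum_rBell] requires. *)
have [|-> _] := key _ _ (card_first_elts rn) n [set: 'I_(n + r)]%SET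
  (finset.subsetT _) _ a good_a.
  by rewrite cardsD finset.setTI card_first_elts // cardsT card_ord addnK.
rewrite sum_rBell; apply: eq_partition_sum => [k|j j0|j j0].
- by rewrite fE G0.
- by rewrite gE.
- by rewrite hE.
Qed.
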